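(* Let $a\in\mathbb{Z}_{>0}$, let $k\in\mathbb{Z}_{\geq 0}$, let $g(x)\in\mathbb{Z}[x]$ have degree $2k+1$, and let $f(x)=g(x)^2+8a-1$. Then the procedure described in the context, run on $f(x)$ (whose leading coefficient has even 2-adic valuation), fails: it does not return a polynomial $h(x)\in\mathbb{Q}[x]$ such that $f(x)-h(x)^2$ is a sum of 4 or fewer squares in $\mathbb{Q}[x]$. That is, the hypothesis of the procedure that the 2-adic valuation of the leading coefficient of the input is odd is necessary.
   Context: A sum of 4 squares in $\mathbb{Q}[x]$ means $f_1^2+f_2^2+f_3^2+f_4^2$ with $f_i\in\mathbb{Q}[x]$ (zero allowed). $\operatorname{ord}_2$ is the 2-adic valuation, and $\log$ is the logarithm in base 2. Procedure (''Reduction to a sum of 4 squares: odd valuation case''). Input: a square-free polynomial $f(x)=c_0+c_1x+\dots+c_nx^n\in\mathbb{Q}[x]$ of degree $n$ with $f(t)>0$ for all $t\in\mathbb{R}$, which is not a sum of 4 squares in $\mathbb{Q}[x]$. Put $k_j:=\operatorname{ord}_2(c_j)$ for $0\le j\le n$; the procedure requires $k_n$ to be odd. Intended output: $h(x)\in\mathbb{Q}[x]$ such that $f(x)-h(x)^2$ is a sum of 4 or fewer squares in $\mathbb{Q}[x]$. (1) Find a positive number $\varepsilon$ with $\varepsilon<\inf\{f(x):x\in\mathbb{R}\}$. (2) Set $l_1:=\lceil-\frac12\log\varepsilon\rceil$. (3) Set $l_2:=\lceil-\frac{k_0}{2}\rceil+1$. (4) Set $l_3:=\left\lceil\max\left\{\frac{jk_n-nk_j}{2n-2j}:0<j<n\right\}\right\rceil$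 (indices $j$ with $c_j=0$ are ignored). (5) Initialize $l:=\max\{l_1,l_2,l_3\}$. (6) While $\gcd(n,2l+k_n)\neq 1$, do $l:=l+1$. (7) Return $h(x):=2^{-l}$. *)

(* Defs.v *)
From mathcomp Require Import all_boot all_order all_algebra.
From mathcomp Require Import classical_sets reals exp.

Set Implicit Arguments.
Unset Strict Implicit.
Unset Printing Implicit Defensive.

Import Order.TTheory GRing.Theory Num.Theory.
Local Open Scope classical_set_scope.
Local Open Scope ring_scope.

Definition sum_of_4_squares (p : {poly rat}) : Prop :=
  exists f1 f2 f3 f4 : {poly rat},
    p = f1 ^+ 2 + f2 ^+ 2 + f3 ^+ 2 + f4 ^+ 2.

(* No nonconstant q has a square dividing p; p = 0 is excluded. *)
Definition square_free (p : {poly rat}) : Prop :=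
  forall q : {poly rat}, q ^+ 2 %| p -> size q = 1%N.

Definition real_eval (R : realType) (f : {poly rat}) (t : R) : R :=
  (map_poly ratr f).[t].

Definition positive_on_reals (R : realType) (f : {poly rat}) : Prop :=
  forall t : R, 0 < real_eval f t.

(* The 2-adic valuation of a nonzero rational (junk value 0 at 0). *)
Definition ord2 (c : rat) : int :=
  (logn 2 `|numq c|%N)%:Z - (logn 2 `|denq c|%N)%:Z.

Definition log2 (R : realType) (x : R) : R := ln x / ln 2.

Definition poly_deg (f : {poly rat}) : nat := (size f).-1.

Definition coef_ord2 (f : {poly rat}) (j : nat) : int := ord2 f`_j.

Definition lead_ord2 (f : {poly rat}) : int := coef_ord2 f (poly_deg f).

(* [inf] is 0 on sets that are not bounded below, so that no positive number is
   below it, in agreement with the infimum being -oo in that case. *)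
Definition below_inf (R : realType) (f : {poly rat}) (eps : R) : Prop :=
  0 < eps /\ eps < inf [set real_eval f t | t in [set: R]].

Definition l1 (R : realType) (eps : R) : int :=
  Num.ceil (- (2^-1 * log2 eps)).

Definition l2 (f : {poly rat}) : int :=
  Num.ceil (- ((coef_ord2 f 0)%:~R / 2 : rat)) + 1.

Definition l3_values (f : {poly rat}) : seq rat :=
  let n := poly_deg f in
  [seq (j%:R * (lead_ord2 f)%:~R - n%:R * (coef_ord2 f j)%:~R)
         / (2 * n%:R - 2 * j%:R)
     | j <- iota 1 n.-1 & f`_j != 0].

(* [None] when there is no index 0 < j < n with a nonzero coefficient: the
   maximum is then over the empty set and l3 puts no constraint on l. *)
Definition l3 (f : {poly rat}) : option int :=
  if l3_values f is x :: s then Some (Num.ceil (\big[Num.max/x]_(y <- s) y))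
  else None.

Definition initial_l (R : realType) (f : {poly rat}) (eps : R) : int :=
  let m := Num.max (l1 eps) (l2 f) in
  if l3 f is Some m3 then Num.max m m3 else m.

(* [while_loop f l l']: started at l, the loop
     while gcd(n, 2l + k_n) <> 1, do l := l + 1
   terminates with the value l'. *)
Inductive while_loop (f : {poly rat}) : int -> int -> Prop :=
| while_stop (l : int) :
    gcdz (poly_deg f)%:Z (2 * l + lead_ord2 f) = 1 -> while_loop f l l
| while_step (l l' : int) :
    gcdz (poly_deg f)%:Z (2 * l + lead_ord2 f) <> 1 ->
    while_loop f (l + 1) l' -> while_loop f l l'.

(* Some run on f, i.e. some choice of eps, terminates and returns h.  The
   preconditions on the input are not tested by the procedure. *)
Definition procedure_returns (R : realType) (f h : {poly rat}) : Prop :=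
  exists (eps : R) (l : int),
    [/\ below_inf f eps, while_loop f (initial_l f eps) l
      & h = ((2 : rat) ^ (- l))%:P].

Definition procedure_succeeds (R : realType) (f : {poly rat}) : Prop :=
  exists h : {poly rat},
    procedure_returns R f h /\ sum_of_4_squares (f - h ^+ 2).

(* Main.v *)
(* Both [deg f = 2(2k+1)] and the valuation of the leading coefficient of
   [f = g^2 + 8a - 1] are even, so the gcd tested by the loop is always even and
   the loop never stops.

   The input [x^2 + 7] meets all the remaining hypotheses.  If it were a sum of
   the squares of four [a_i x + b_i], then [|a|^2 = 1], [a . b = 0] and
   [|b|^2 = 7], so that the quaternion [conj(a) b] would be purely imaginary of
   norm 7; but 7 is not a sum of three rational squares. *)
Require Import Defs.
From mathcomp Require Import all_boot all_order all_algebra.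
From mathcomp Require Import classical_sets reals exp.
From mathcomp Require Import zify ring lra.

Import Order.TTheory GRing.Theory Num.Theory.
Local Open Scope ring_scope.

(** The constant lies below the leading term of the square, so the leading coefficient of [f] is the
    square of an integer and squaring doubles its valuation. *)
Lemma lead_ord2_sqr_addC (g : {poly int}) (c : rat) :
  (1 < size g)%N ->
  let f := map_poly intr g ^+ 2 + c%:P in
  poly_deg f = ((size g).-1).*2 /\ (2 %| lead_ord2 f)%Z.
Proof.
move=> g_gt1 f; set G : {poly rat} := map_poly intr g.
have sG : size G = size g by rewrite size_map_inj_poly //; exact: intr_inj.
have G0 : G != 0 by rewrite -size_poly_gt0 sG; lia.
have sG2 : size (G ^+ 2) = ((size g).-1).*2.+1.
  by rewrite expr2 size_mul // sG; lia.
have lt_c : (size c%:P < size (G ^+ 2))%N.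
  by rewrite sG2; apply: leq_ltn_trans (size_polyC_leq1 _) _; lia.
split; first by rewrite /poly_deg /f size_polyDl // sG2.
have -> : lead_ord2 f = ord2 (lead_coef f) by [].
rewrite /f lead_coefDl // lead_coef_exp lead_coef_map_inj //; last exact: intr_inj.
rewrite -rmorphXn /ord2 /= numq_int denq_int subr0 abszX lognX.
by rewrite PoszM dvdz_mulr.
Qed.

Lemma while_loop_even_diverges (f : {poly rat}) (l l' : int) :
  ~~ odd (poly_deg f) -> (2 %| lead_ord2 f)%Z -> ~ while_loop f l l'.
Proof.
(* Induction on the run: the step case is the induction hypothesis, and the stop case would make 2
   divide 1. *)
move=> n_even k_even; elim=> // {}l gcd1.
have : (2 %| gcdz (poly_deg f) (2 * l + lead_ord2 f))%Z.
  by rewrite dvdz_gcd rpredD ?dvdz_mulr // dvdzE dvdn2 n_even.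
by rewrite gcd1.
Qed.

Lemma procedure_fails_sqr_addC (R : realType) (g : {poly int}) (c : rat) :
  (1 < size g)%N -> ~ procedure_succeeds R (map_poly intr g ^+ 2 + c%:P).
Proof.
move=> g_gt1 [h [[eps [l [_ loop _]]] _]].
have [deg_f lead_f] := lead_ord2_sqr_addC g c g_gt1.
by apply: while_loop_even_diverges loop; rewrite // deg_f odd_double.
Qed.

(** The even case keeps the half [u], which the descent below passes to; the odd case holds because
    [u * (u + 1)] is even. *)
Lemma sqrn_mod8 (x : nat) :
  (exists2 u, x = 2 * u & x * x = 4 * (u * u))%N \/
  (exists t, x * x = 8 * t + 1)%N.
Proof.
have [x_odd|x_even] := boolP (odd x); last first.
  have def_x : x = (2 * x./2)%N by lia.
  by left; exists x./2; rewrite // {1 2}def_x mulnACA.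
have [u def_x] : exists u, x = (2 * u + 1)%N by exists x./2; lia.
have [t def_t] : exists t, (u * u.+1 = 2 * t)%N.
  exists (u * u.+1)./2; suff : ~~ odd (u * u.+1)%N by lia.
  by rewrite oddM /= andbN.
by right; exists t; rewrite def_x; nia.
Qed.

(** Infinite descent on [w]. If [w] is odd, the right side is 7 mod 8, which no three of the
    residues 0, 1, 4 add up to. If [w] is even, the sum is 0 mod 4, which forces [x], [y], [z] to be
    even. *)
Lemma three_sqrn_eq_7sqrn (x y z w : nat) :
  (x * x + y * y + z * z = 7 * (w * w))%N -> w = 0%N.
Proof.
elim/ltn_ind: w x y z => w IHw x y z.
case: (sqrn_mod8 w) (sqrn_mod8 x) (sqrn_mod8 y) (sqrn_mod8 z)
  => [[w' def_w ->]|[w' ->]]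
     [[x' def_x ->]|[x' ->]]
     [[y' def_y ->]|[y' ->]]
     [[z' def_z ->]|[z' ->]] eq7; try lia.
(* Only the case of four even numbers is left; halving decreases [w] strictly only when [w] is
   positive. *)
have [w0|w_gt0] := posnP w; first by [].
by rewrite def_w (IHw w' _ x' y' z') //; lia.
Qed.

Lemma three_sqr_rat_neq7 (x y z : rat) : x ^+ 2 + y ^+ 2 + z ^+ 2 != 7.
Proof.
apply/eqP => eq7.
(* Over the common denominator [d], the rationals [x], [y], [z] are [a / d], [b / d], [c / d]. *)
pose a := numq x * (denq y * denq z); pose b := numq y * (denq x * denq z).
pose c := numq z * (denq x * denq y); pose d := denq x * denq y * denq z.
have eq_int : a ^+ 2 + b ^+ 2 + c ^+ 2 = 7 * d ^+ 2.
  apply: (@intr_inj rat).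
  rewrite !(rmorphD, rmorphM, rmorphXn, rmorph_nat) /= !numqE -eq7.
  by ring.
have d_neq0 : d != 0 by rewrite !mulf_neq0 ?denq_neq0.
have : `|d|%N = 0%N.
  apply: (@three_sqrn_eq_7sqrn `|a| `|b| `|c|).
  have sqr_absz (m : int) : (`|m| * `|m|)%N = m ^+ 2 :> int.
    by rewrite PoszM abszE -expr2 real_normK ?num_real.
  by move: eq_int; rewrite -!sqr_absz; lia.
by move/eqP; rewrite absz_eq0 (negPf d_neq0).
Qed.

(** Nonnegative leading coefficients cannot cancel. The sign of the new leading coefficient is part
    of the conclusion so that the lemma can be iterated. *)
Lemma size_add_lead_ge0 (R : realDomainType) (p q : {poly R}) :
  0 <= lead_coef p -> 0 <= lead_coef q ->
  size (p + q) = maxn (size p) (size q) /\ 0 <= lead_coef (p + q).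
Proof.
move=> p_ge0 q_ge0; have [lt_pq|lt_qp|eq_pq] := ltngtP (size p) (size q).
- by rewrite addrC size_polyDl ?lead_coefDl.
- by rewrite size_polyDl ?lead_coefDl.
have [p0|p_neq0] := eqVneq p 0.
  by rewrite p0 add0r -eq_pq p0.
have p_gt0 : 0 < lead_coef p by rewrite lt_def lead_coef_eq0 p_neq0.
have coef_gt0 : 0 < (p + q)`_(size p).-1.
  by rewrite coefD {2}eq_pq -!/(lead_coef _) ltr_pwDl.
have size_pq : size (p + q) = size p.
  apply/eqP; rewrite eqn_leq; apply/andP; split.
    by rewrite (leq_trans (size_polyD _ _)) // -eq_pq maxnn.
  rewrite -(ltn_predK (_ : 0 < size p)%N) ?size_poly_gt0 // ltnNge.
  by apply: contraTN coef_gt0 => /leq_sizeP ->; rewrite ?ltxx.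
by rewrite /lead_coef size_pq ltW.
Qed.

Lemma size_sum4_sqr (R : realDomainType) (p q r s : {poly R}) :
  size (p ^+ 2 + q ^+ 2 + r ^+ 2 + s ^+ 2) =
  maxn (maxn (maxn (size (p ^+ 2)) (size (q ^+ 2))) (size (r ^+ 2)))
    (size (s ^+ 2)).
Proof.
have sqr_ge0 (u : {poly R}) : 0 <= lead_coef (u ^+ 2).
  by rewrite lead_coef_exp sqr_ge0.
have [pq pq_ge0] := size_add_lead_ge0 _ _ _ (sqr_ge0 p) (sqr_ge0 q).
have [pqr pqr_ge0] := size_add_lead_ge0 _ _ _ pq_ge0 (sqr_ge0 r).
by have [-> _] := size_add_lead_ge0 _ _ _ pqr_ge0 (sqr_ge0 s); rewrite pqr pq.
Qed.

Lemma size_X2addC (R : nzRingType) (c : R) : size ('X^2 + c%:P) = 3%N.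
Proof.
by rewrite size_polyDl size_polyXn // (leq_ltn_trans (size_polyC_leq1 _)).
Qed.

Lemma X2add7_not_sum4_sqr : ~ sum_of_4_squares ('X^2 + 7%:P).
Proof.
move=> [p [q [r [s eqf]]]].
have := eq_leq (congr1 (fun u : {poly rat} => size u) (esym eqf)).
rewrite size_X2addC size_sum4_sqr !geq_max => /andP[/andP[/andP[sp sq] sr] ss].
(* By the size bounds each of the four polynomials has degree at most 1, so its square expands as
   that of a binomial. *)
have sqr_coef (u : {poly rat}) : (size (u ^+ 2) <= 3)%N ->
  [/\ (u ^+ 2)`_0 = u`_0 ^+ 2, (u ^+ 2)`_1 = 2 * (u`_0 * u`_1)
    & (u ^+ 2)`_2 = u`_1 ^+ 2].
  move=> size_u2; have u2 : u`_2 = 0.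
    apply: nth_default; have [->|u0] := eqVneq u 0; first by rewrite size_poly0.
    by move: size_u2; rewrite expr2 size_mul //; move: (size u) => m; lia.
  by rewrite !expr2 !coefM !big_ord_recr !big_ord0 /= u2; split; ring.
have [p0 p1 p2] := sqr_coef p sp.
have [q0 q1 q2] := sqr_coef q sq.
have [r0 r1 r2] := sqr_coef r sr.
have [s0 s1 s2] := sqr_coef s ss.
(* Comparing coefficients: [e0] is [|b|^2 = 7], [e1] gives [a . b = 0], and [e2] is [|a|^2 = 1]. *)
have e0 := congr1 (fun u : {poly rat} => u`_0) eqf.
have e1 := congr1 (fun u : {poly rat} => u`_1) eqf.
have e2 := congr1 (fun u : {poly rat} => u`_2) eqf.
rewrite /= !coefD coefXn coefC ?(p0, q0, r0, s0) /= add0r in e0.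
rewrite /= !coefD coefXn coefC ?(p1, q1, r1, s1) /= addr0 in e1.
rewrite /= !coefD coefXn coefC ?(p2, q2, r2, s2) /= addr0 in e2.
have dot0 : p`_0 * p`_1 + q`_0 * q`_1 + r`_0 * r`_1 + s`_0 * s`_1 = 0 by lra.
(* The imaginary components of the quaternion product [conj(a) b]. *)
have /eqP[] := three_sqr_rat_neq7
  (p`_1 * q`_0 - q`_1 * p`_0 - r`_1 * s`_0 + s`_1 * r`_0)
  (p`_1 * r`_0 - r`_1 * p`_0 - s`_1 * q`_0 + q`_1 * s`_0)
  (p`_1 * s`_0 - s`_1 * p`_0 - q`_1 * r`_0 + r`_1 * q`_0).
(* Euler's four-square identity, with the square of the real part [a . b] moved to the other
   side. *)
transitivity ((p`_1 ^+ 2 + q`_1 ^+ 2 + r`_1 ^+ 2 + s`_1 ^+ 2) *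
  (p`_0 ^+ 2 + q`_0 ^+ 2 + r`_0 ^+ 2 + s`_0 ^+ 2) -
  (p`_0 * p`_1 + q`_0 * q`_1 + r`_0 * r`_1 + s`_0 * s`_1) ^+ 2); first by ring.
by rewrite -e0 -e2 dot0 mul1r expr0n subr0.
Qed.

(** By degrees, a nonconstant [q] would be linear; its rational root would then be a zero of
    [x^2 + 7], which is positive. *)
Lemma X2add7_square_free : square_free ('X^2 + 7%:P).
Proof.
move=> q q2_dvd; have f_neq0 : 'X^2 + 7%:P != 0 :> {poly rat}.
  by rewrite -size_poly_gt0 size_X2addC.
have q_neq0 : q != 0.
  by apply: contraNneq f_neq0 => q0; rewrite q0 expr0n dvd0p in q2_dvd.
have := dvdp_leq f_neq0 q2_dvd; rewrite size_X2addC expr2 size_mul // => q_le.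
have := size_poly_gt0 q; rewrite q_neq0 => q_gt0.
have [q_size2|] := eqVneq (size q) 2%N; last first.
  by move: (size q) q_gt0 q_le; lia.
have [x qx0] : exists x, root q x.
  exists (- q`_0 / q`_1); have q1 : q`_1 != 0.
    by rewrite -[1%N]/(2.-1) -q_size2 -/(lead_coef q) lead_coef_eq0.
  rewrite rootE horner_coef q_size2 !big_ord_recr big_ord0 /=.
  by apply/eqP; field.
have : root ('X^2 + 7%:P) x.
  rewrite -dvdp_XsubCl; apply: dvdp_trans q2_dvd.
  by rewrite dvdp_XsubCl expr2 rootM qx0.
have f_gt0 : 0 < x ^+ 2 + 7 by apply: ltr_wpDl; first exact: sqr_ge0.
by rewrite rootE hornerD hornerXn hornerC gt_eqF.
Qed.

Lemma X2add7_positive (R : realType) : positive_on_reals R ('X^2 + 7%:P).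
Proof.
move=> t; rewrite /real_eval rmorphD /= map_polyXn map_polyC /= hornerD hornerXn hornerC.
by rewrite rmorph_nat; apply: ltr_wpDl; first exact: sqr_ge0.
Qed.

(** The second conjunct expresses the necessity of the oddness hypothesis: the other input
    conditions alone do not guarantee success. *)
Theorem proposition1p2 (R : realType) :
  (forall (a : int) (k : nat) (g : {poly int}),
     0 < a -> size g = (2 * k + 1).+1 ->
     let f : {poly rat} :=
       map_poly intr g ^+ 2 + ((8 * a - 1)%:~R)%:P in
     (2 %| lead_ord2 f)%Z /\ ~ procedure_succeeds R f)
  /\
  ~ (forall f : {poly rat},
       square_free f -> positive_on_reals R f -> ~ sum_of_4_squares f ->
       procedure_succeeds R f).
Proof.
split=> [a k g _ size_g f | succeeds].
  have g_gt1 : (1 < size g)%N by rewrite size_g; lia.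
  split; last exact: procedure_fails_sqr_addC.
  exact: (lead_ord2_sqr_addC g _ g_gt1).2.
(* The counterexample is the member of the family with [a = 1], [k = 0], [g = 'X]. *)
apply: (@procedure_fails_sqr_addC R 'X 7); first by rewrite size_polyX.
rewrite map_polyX; apply: succeeds.
- exact: X2add7_square_free.
- exact: X2add7_positive.
- exact: X2add7_not_sum4_sqr.
Qed.
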